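(* Let $G$ be a theta-free and prism-free graph and let $\Sigma$ be a pyramid in $G$ with apex $a$, base $\{b_1,b_2,b_3\}$ and paths $P_1,P_2,P_3$. Let $u,v\in V(G)\setminus N[Z(\Sigma)]$ belong to distinct paths of $\Sigma$. Then $N[Z(\Sigma)]$ separates $u$ and $v$ in $G$.
   Context: Graphs are finite and simple. A path in $G$ is an induced subgraph that is a path; a hole is an induced cycle of length at least four. A theta is a graph consisting of two non-adjacent vertices and three pairwise internally disjoint paths between them, each of length at least two, with pairwise anticomplete interiors. A prism is a graph consisting of two triangles $\{a_1,a_2,a_3\}$, $\{b_1,b_2,b_3\}$ and three pairwise disjoint paths $P_1,P_2,P_3$, where $P_i$ has ends $a_i,b_i$ (length zero allowed), such that for distinct $i,j$ the only edges between $P_i$ and $P_j$ are $a_ia_j$ and $b_ib_j$, and $P_i\cup P_j$ induces a hole. Theta-free/prism-free means no induced subgraph isomorphic to a theta/prism. A pyramid is a graph consisting of a vertex $a$ (apex), a triangle $\{b_1,b_2,b_3\}$ (base) not containing $a$, and three paths $P_1,P_2,P_3$ of length at least one, $P_i$ having ends $a$ and $b_i$, such that for distinct $i,j$ the sets $V(P_i)\setminus\{a\}$ and $V(P_j)\setminus\{a\}$ are disjoint, $b_ib_j$ is the only edge between them, and $P_i\cup P_j$ induces a hole. A pyramid in $G$ is an induced subgraph that is a pyramid. $Z(\Sigma)=N_\Sigma[a]\cup\{b_1,b_2,b_3\}$, where $N_\Sigma[a]$ is $a$ together with its neighbors in $\Sigma$. For $X\subseteq V(G)$, $N[X]$ is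 $X$ together with all vertices of $G$ having a neighbor in $X$. A separation of $G$ is a triple $(L,M,R)$ of pairwise disjoint sets with union $V(G)$, $L,R$ non-empty and no edges between $L$ and $R$; $M\subseteq V(G)\setminus\{x,y\}$ separates $x$ and $y$ if there is a separation $(L,M,R)$ with $x\in L$, $y\in R$. *)

(* Defs.v *)
From mathcomp Require Import all_boot.
Set Implicit Arguments.
Unset Strict Implicit.
Unset Printing Implicit Defensive.

(* A finite simple graph is a symmetric irreflexive relation E on a finType V.
   Subgraphs are always induced, so they are given by their vertices. *)

Section Graphs.
Variables (V : finType) (E : rel V).

(* The vertices of an induced path from x to y, listed in order from x to y;
   the length of the path is (size p).-1. *)
Definition induced_path (x y : V) (p : seq V) : Prop :=
  [/\ 0 < size p, uniq p, head x p = x, last x p = y &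
      forall i j, i < size p -> j < size p ->
        E (nth x p i) (nth x p j) = (j == i.+1) || (i == j.+1)].

Definition path_length (p : seq V) : nat := (size p).-1.

Definition interior (x y : V) (p : seq V) : {set V} :=
  [set z in p | (z != x) && (z != y)].

Definition induces_hole (S : {set V}) : Prop :=
  exists c : seq V,
    [/\ uniq c, 4 <= size c, S = [set x in c] &
        {in c &, forall x y, E x y = (y == next c x) || (x == next c y)}].

Definition anticomplete (A B : {set V}) : Prop :=
  {in A & B, forall x y, ~~ E x y}.

Definition triangle (t : 'I_3 -> V) : Prop :=
  forall i j, i != j -> E (t i) (t j).

(* In theta, prism and pyramid the adjacency between any two listed vertices
   of G is prescribed, so such a configuration in G is exactly an induced
   subgraph of G (on the union of the paths) that is a theta, prism, pyramid. *)
Definition theta (a b : V) (P : 'I_3 -> seq V) : Prop :=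
  [/\ ~~ E a b,
      forall i, induced_path a b (P i) /\ 2 <= path_length (P i) &
      forall i j, i != j ->
        [disjoint interior a b (P i) & interior a b (P j)] /\
        anticomplete (interior a b (P i)) (interior a b (P j))].

Definition prism (a b : 'I_3 -> V) (P : 'I_3 -> seq V) : Prop :=
  [/\ triangle a, triangle b,
      forall i, induced_path (a i) (b i) (P i) &
      forall i j, i != j ->
        [/\ [disjoint P i & P j],
            {in P i & P j, forall x y,
               E x y = ((x == a i) && (y == a j)) || ((x == b i) && (y == b j))} &
            induces_hole [set x | (x \in P i) || (x \in P j)]]].

Definition theta_free : Prop := forall a b P, ~ theta a b P.
Definition prism_free : Prop := forall a b P, ~ prism a b P.

Definition pyramid (a : V) (b : 'I_3 -> V) (P : 'I_3 -> seq V) : Prop :=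
  [/\ triangle b, forall i, a != b i,
      forall i, induced_path a (b i) (P i) /\ 1 <= path_length (P i) &
      forall i j, i != j ->
        [/\ [disjoint [set x in P i] :\ a & [set x in P j] :\ a],
            {in [set x in P i] :\ a & [set x in P j] :\ a, forall x y,
               E x y = (x == b i) && (y == b j)} &
            induces_hole [set x | (x \in P i) || (x \in P j)]]].

(* Z(Sigma) = N_Sigma[a] together with the base. *)
Definition pyramid_Z (a : V) (b : 'I_3 -> V) (P : 'I_3 -> seq V) : {set V} :=
  [set x | [exists i, x \in P i] && ((x == a) || E a x)]
    :|: [set b i | i : 'I_3].

Definition closed_nbhd (X : {set V}) : {set V} :=
  X :|: [set y | [exists x in X, E y x]].

Definition separation (L M R : {set V}) : Prop :=
  [/\ [/\ [disjoint L & M], [disjoint M & R] & [disjoint L & R]],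
      L :|: M :|: R = [set: V], L != set0, R != set0 & anticomplete L R].

Definition separates (M : {set V}) (x y : V) : Prop :=
  M \subset ~: [set x; y] /\
  exists L R : {set V}, [/\ separation L M R, x \in L & y \in R].

End Graphs.

(* Main.v *)
(* Call a vertex far if it lies outside N[Z]. If N[Z] does not separate u and v,
   some walk of far vertices attaches to two different paths of the pyramid.
   Take a shortest one, with ends r and r', attaching to P_i and P_j. If it is
   a single vertex attaching to all three paths, these attachments give a theta
   with ends r and the apex. Otherwise only r attaches to P_i, only r' to P_j,
   and nothing to the third path. If r has a single neighbour x on P_i there is
   a theta with ends x and the apex; if it has two nonadjacent neighbours there
   is a theta with ends r and the apex; so its neighbours on P_i form an edge.
   The same holds for r' and P_j, and then the two triangles span a prism.

   The paths of a theta or prism need not be exhibited: it is enough to give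
   sets of vertices that connect the required ends and have no unwanted edges
   between them, and take induced paths inside these sets. *)

Require Import Defs.
From mathcomp Require Import all_boot.
From mathcomp Require Import zify.
Set Implicit Arguments.
Unset Strict Implicit.
Unset Printing Implicit Defensive.

(** * Connection inside a vertex set, and induced paths *)

Section Linked.
Variables (V : finType) (E : rel V).
Hypotheses (E_sym : symmetric E) (E_irr : irreflexive E).

Definition restr (T : {set V}) : rel V :=
  [rel x y | [&& x \in T, y \in T & E x y]].

(** As [connect] is reflexive, [linked T x x] holds even for [x] outside [T]. *)
Definition linked (T : {set V}) (x y : V) : bool := connect (restr T) x y.

Lemma linked_trans T y x z : linked T x y -> linked T y z -> linked T x z.
Proof. exact: connect_trans. Qed.

Lemma linked_sym T x y : linked T x y = linked T y x.
Proof.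
apply: sym_connect_sym => u v.
by rewrite /restr /= E_sym; case: (u \in T); case: (v \in T).
Qed.

Lemma linked1 (T : {set V}) x y : x \in T -> y \in T -> E x y -> linked T x y.
Proof. by move=> xT yT xy; apply: connect1; rewrite /restr /= xT yT. Qed.

Lemma linked_sub (T T' : {set V}) x y :
  T \subset T' -> linked T x y -> linked T' x y.
Proof.
move=> /subsetP TT'; apply: connect_sub => u v /and3P[uT vT uv].
by apply: linked1; rewrite ?TT'.
Qed.

Lemma induced_path_drop x y p k :
  induced_path E x y p -> k < size p -> induced_path E (nth x p k) y (drop k p).
Proof.
move=> [p0 up hp lp pE] kp; split.
- by rewrite size_drop subn_gt0.
- exact: drop_uniq.
- by rewrite -nth0 nth_drop addn0; apply: set_nth_default.
- rewrite -lp !(last_nth x) (drop_nth x kp) /= .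
  case: p {p0 up hp lp pE} kp => //= z p kp.
  rewrite size_drop.
  have := nth_drop k x (z :: p) (size p - k); rewrite (drop_nth x) //= => ->.
  by congr nth; lia.
- move=> i j; rewrite size_drop => ik jk.
  have ik' : k + i < size p by lia.
  have jk' : k + j < size p by lia.
  rewrite !nth_drop !(set_nth_default x (nth _ _ _)) // pE //.
  by apply/idP/idP; lia.
Qed.

(** Induction on the walk: let [p] be an induced path from the second vertex. If [x] lies on [p],
    keep [p] from [x] on; otherwise prepend [x] to the part of [p] that starts at the last neighbour
    of [x]. *)
Lemma linked_induced_path (T : {set V}) x y :
  x \in T -> linked T x y ->
  exists2 p, induced_path E x y p & {subset p <= T}.
Proof.
move=> xT /connectP[s]; elim: s x xT => [|u s IHs] x xT /=.
  move=> _ ->; exists [:: x]; last by move=> z; rewrite inE => /eqP ->.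
  by split=> // -[|i] [|j] //= _ _; rewrite E_irr.
move=> /andP[/and3P[_ uT xu] us] ylast.
have [p pP pT] := IHs u uT us ylast.
have [p0 up hp lp pE] := pP.
have [xp|xNp] := boolP (x \in p).
  exists (drop (index x p) p); last by move=> z /mem_drop /pT.
  have ip : index x p < size p by rewrite index_mem.
  by have := induced_path_drop pP ip; rewrite nth_index.
pose Q k := (k < size p) && E x (nth u p k).
have Q0 : exists k, Q k by exists 0; rewrite /Q p0 nth0 hp.
have Qb k : Q k -> k <= size p by case/andP=> /ltnW.
have [k /andP[kp xk] kmax] := ex_maxnP Q0 Qb.
have [q0 uq hq lq qE] := induced_path_drop pP kp.
exists (x :: drop k p); last first.
  by move=> z; rewrite inE => /orP[/eqP -> //|/mem_drop /pT].
split=> //=.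
- by rewrite uq andbT; apply: contra xNp => /mem_drop.
- by move: lq q0; case: (drop k p).
have xE l : l < size (drop k p) -> E x (nth x (drop k p) l) = (l == 0).
  rewrite size_drop => lk; rewrite nth_drop.
  have lp' : k + l < size p by lia.
  rewrite (set_nth_default u) //.
  case: l lk lp' => [|l] lk lp'; first by rewrite addn0 xk.
  apply/negbTE/negP => xl.
  by have := kmax (k + l.+1); rewrite /Q lp' xl => /(_ isT); lia.
move=> [|i] [|j] /= ip jp; rewrite ?E_irr //.
- by rewrite xE // eqSS orbF.
- by rewrite E_sym xE // eqSS orbC.
- by rewrite !(set_nth_default (nth u p k) x) // qE.
Qed.

(** * Thetas and prisms from sets of vertices *)

Definition separated (A B : {set V}) : Prop :=
  forall x y, x \in A -> y \in B -> x != y /\ ~~ E x y.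

Lemma separated_sym A B : separated A B -> separated B A.
Proof.
by move=> AB x y xB yA; have [] := AB y x yA xB; rewrite eq_sym E_sym.
Qed.

Lemma separatedUl A B C : separated A C -> separated B C -> separated (A :|: B) C.
Proof. by move=> sAC sBC x y /setUP[]; [apply: sAC | apply: sBC]. Qed.

Lemma separatedUr A B C : separated A B -> separated A C -> separated A (B :|: C).
Proof. by move=> sAB sAC x y xA /setUP[]; [apply: sAB | apply: sAC]. Qed.

Lemma induced_path_length x y p :
  induced_path E x y p -> x != y -> ~~ E x y -> 2 <= path_length p.
Proof.
case: p => [[]//|z [|w [|//]]] [_ _ /= -> <- pE]; first by rewrite eqxx.
by have /= -> := pE 0 1.
Qed.

(** An induced path inside [[set x; y] :|: S1] has its interior in [S1], and likewise for [S2] and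
    [S3]; [separated] includes disjointness. As [x] and [y] are distinct and non-adjacent, each path
    has length at least two. *)
Lemma separated_theta x y (S1 S2 S3 : {set V}) :
  theta_free E -> x != y -> ~~ E x y ->
  linked ([set x; y] :|: S1) x y -> linked ([set x; y] :|: S2) x y ->
  linked ([set x; y] :|: S3) x y ->
  separated S1 S2 -> separated S1 S3 -> separated S2 S3 -> False.
Proof.
move=> tf xy nxy L1 L2 L3 S12 S13 S23.
pose S (i : 'I_3) := nth set0 [:: S1; S2; S3] i.
have SP i j : i != j -> separated (S i) (S j).
  by case: i j => [[|[|[|i]]] //= hi] [[|[|[|j]]] //= hj] _; rewrite /S //=;
    apply: separated_sym.
have LP i : linked ([set x; y] :|: S i) x y.
  by case: i => [[|[|[|i]]] //= hi]; rewrite /S.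
have ex i : exists2 p, induced_path E x y p & {subset p <= [set x; y] :|: S i}.
  by apply: linked_induced_path (LP i); rewrite !inE eqxx.
have [P1 P1i P1S] := ex ord0.
have [P2 P2i P2S] := ex (inord 1).
have [P3 P3i P3S] := ex (inord 2).
move: P2S P3S; rewrite /S !inordK //= => P2S P3S.
pose P (i : 'I_3) := nth [::] [:: P1; P2; P3] i.
have PP i : induced_path E x y (P i).
  by case: i => [[|[|[|i]]] //= hi]; rewrite /P.
have PS i : {subset P i <= [set x; y] :|: S i}.
  by case: i => [[|[|[|i]]] //= hi]; rewrite /P /S.
have IS i z : z \in interior x y (P i) -> z \in S i.
  rewrite inE => /andP[/PS]; rewrite !inE -orbA => /or3P[->|->|//];
  by rewrite ?andbF.
apply: (tf x y P); split=> //.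
  by move=> i; split=> //; apply: induced_path_length (PP i) _ _.
move=> i j ij; split.
  rewrite disjoint_subset; apply/subsetP => z zi; rewrite inE; apply/negP => zj.
  by have [] := SP i j ij z z (IS _ _ zi) (IS _ _ zj); rewrite eqxx.
by move=> z w zi wj; have [] := SP i j ij z w (IS _ _ zi) (IS _ _ wj).
Qed.

(** The relation that a prism prescribes between two of its paths, disjointness included. For
    arbitrary sets, it passes to paths inside them. *)
Definition rungs (A B : {pred V}) (x x' y y' : V) : Prop :=
  {in A & B, forall z w, z != w /\
     E z w = ((z == x) && (w == x')) || ((z == y) && (w == y'))}.

Lemma rungs_sym A B x x' y y' : rungs A B x x' y y' -> rungs B A x' x y' y.
Proof.
move=> AB z w zB wA; have [zw e] := AB w z wA zB.
by rewrite eq_sym zw E_sym e ![(w == _) && _]andbC.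
Qed.

Lemma next_nth_mod (c : seq V) x i :
  uniq c -> i < size c ->
  next c (nth x c i) = nth x c (if i.+1 < size c then i.+1 else 0).
Proof.
move=> uc ic; rewrite next_nth mem_nth //.
case: c uc ic => // z c uc ic.
rewrite index_uniq //; case: ifP => /= ic'; first exact: set_nth_default.
by rewrite nth_default //; move: ic'; rewrite /=; lia.
Qed.

Lemma induced_path_nth_first x y p k :
  induced_path E x y p -> k < size p -> (nth x p k == x) = (k == 0).
Proof.
move=> [p0 up hp _ _] kp.
by rewrite -{2}hp -nth0 nth_uniq.
Qed.

Lemma induced_path_nth_last x y p k :
  induced_path E x y p -> k < size p -> (nth x p k == y) = (k == (size p).-1).
Proof.
move=> [p0 up _ lp _] kp; rewrite -lp -nth_last.
by rewrite nth_uniq // ltn_predL.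
Qed.

(** The hole runs along [p] from [x] to [y], crosses to [y'], returns along [q] to [x'] and closes
    at [x]. *)
Lemma rungs_hole x y p x' y' q :
  induced_path E x y p -> induced_path E x' y' q ->
  rungs (mem p) (mem q) x x' y y' -> 4 <= size p + size q ->
  induces_hole E [set z | (z \in p) || (z \in q)].
Proof.
move=> pP qP pq pq4; exists (p ++ rev q).
have [p0 up hp lp pE] := pP; have [q0 uq hq lq qE] := qP.
have uc : uniq (p ++ rev q).
  rewrite cat_uniq up rev_uniq uq andbT /=; apply/hasPn => z.
  rewrite mem_rev => zq; apply/negP => zp.
  by have [] := pq z z zp zq; rewrite eqxx.
have sc : size (p ++ rev q) = size p + size q by rewrite size_cat size_rev.
split=> //; first by rewrite sc.
  by apply/setP => z; rewrite !inE mem_cat mem_rev.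
set c := p ++ rev q in uc sc *.
have cl i : i < size p -> nth x c i = nth x p i.
  by move=> ip; rewrite nth_cat ip.
have cr i : size p <= i -> i < size c ->
    nth x c i = nth x' q (size p + size q - i.+1).
  move=> ip ic; rewrite nth_cat ltnNge ip /= nth_rev; last by lia.
  rewrite (set_nth_default x'); last by lia.
  by congr nth; lia.
suff H i j : i <= j -> i < size c -> j < size c ->
  E (nth x c i) (nth x c j) =
    (nth x c j == next c (nth x c i)) || (nth x c i == next c (nth x c j)).
  move=> z w /(nthP x)[i ic <-] /(nthP x)[j jc <-].
  have [ij|/ltnW ji] := leqP i j; first exact: H.
  by rewrite E_sym H // orbC.
move=> ij ic jc; rewrite !next_nth_mod //.
have lt_next k : k < size c -> (if k.+1 < size c then k.+1 else 0) < size c.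
  by case: ifP; lia.
rewrite !nth_uniq ?lt_next //.
have [jp|pj] := ltnP j (size p).
  rewrite !cl ?pE //; try lia.
  by case: ifP; case: ifP; lia.
have [ip|pi] := ltnP i (size p); last first.
  rewrite !cr // qE; try lia.
  by case: ifP; case: ifP; lia.
(* Here [i] lies on [p] and [j] on [q]: the two edges allowed by [rungs] are the crossing inside [c]
   and its closing edge. *)
rewrite cl // cr //.
have mq : size p + size q - j.+1 < size q by lia.
move Em : (size p + size q - j.+1) => m in mq *.
have [||_ ->] := pq (nth x p i) (nth x' q m); [exact: mem_nth | exact: mem_nth |].
rewrite (induced_path_nth_first pP ip) (induced_path_nth_last pP ip).
rewrite (induced_path_nth_first qP mq) (induced_path_nth_last qP mq).
move: (size p) (size q) (size c) sc ip pj mq Em jc => np nq nc sc ip pj mq Em jc.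
have -> : i.+1 < nc by lia.
have [jl|jl] := ltnP j.+1 nc; apply/idP/idP; lia.
Qed.

(** The path in [S1] may be a single vertex. The non-adjacent ends in [S2] and in [S3] force three
    vertices on each of the other paths, so any two paths have the four vertices that a hole
    needs. *)
Lemma rungs_prism x1 x2 x3 y1 y2 y3 (S1 S2 S3 : {set V}) :
  prism_free E ->
  x1 \in S1 -> x2 \in S2 -> x3 \in S3 -> y1 \in S1 -> y2 \in S2 -> y3 \in S3 ->
  linked S1 x1 y1 -> linked S2 x2 y2 -> linked S3 x3 y3 ->
  x2 != y2 -> ~~ E x2 y2 -> x3 != y3 -> ~~ E x3 y3 ->
  rungs (mem S1) (mem S2) x1 x2 y1 y2 ->
  rungs (mem S1) (mem S3) x1 x3 y1 y3 ->
  rungs (mem S2) (mem S3) x2 x3 y2 y3 -> False.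
Proof.
move=> pf x1S x2S x3S y1S y2S y3S L1 L2 L3 xy2 nxy2 xy3 nxy3 S12 S13 S23.
have [P1 P1i P1S] := linked_induced_path x1S L1.
have [P2 P2i P2S] := linked_induced_path x2S L2.
have [P3 P3i P3S] := linked_induced_path x3S L3.
pose S (i : 'I_3) := nth set0 [:: S1; S2; S3] i.
pose P (i : 'I_3) := nth [::] [:: P1; P2; P3] i.
pose x (i : 'I_3) := nth x1 [:: x1; x2; x3] i.
pose y (i : 'I_3) := nth y1 [:: y1; y2; y3] i.
have SP i j : i != j -> rungs (mem (S i)) (mem (S j)) (x i) (x j) (y i) (y j).
  by case: i j => [[|[|[|i]]] //= hi] [[|[|[|j]]] //= hj] _; rewrite /S //=;
    apply: rungs_sym.
have PP i : induced_path E (x i) (y i) (P i).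
  by case: i => [[|[|[|i]]] //= hi]; rewrite /P.
have PS i : {subset P i <= S i}.
  by case: i => [[|[|[|i]]] //= hi]; rewrite /P /S.
have xS i : x i \in S i by case: i => [[|[|[|i]]] //= hi].
have yS i : y i \in S i by case: i => [[|[|[|i]]] //= hi].
have R i j : i != j -> rungs (mem (P i)) (mem (P j)) (x i) (x j) (y i) (y j).
  by move=> ij z w zi wj; apply: SP; rewrite ?inE ?(PS i) ?(PS j).
have sz i : 0 < size (P i) by have [] := PP i.
have sz4 i j : i != j -> 4 <= size (P i) + size (P j).
  have s1 : 0 < size P1 := sz ord0.
  have s2 : 2 < size P2 by have := induced_path_length P2i xy2 nxy2; case: (P2).
  have s3 : 2 < size P3 by have := induced_path_length P3i xy3 nxy3; case: (P3).
  by case: i j => [[|[|[|i]]] //= hi] [[|[|[|j]]] //= hj] _; rewrite /P /=;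
    clear - s1 s2 s3; lia.
apply: (pf x y P); split.
- by move=> i j ij; have [_ ->] := SP i j ij _ _ (xS i) (xS j); rewrite !eqxx.
- by move=> i j ij; have [_ ->] := SP i j ij _ _ (yS i) (yS j);
    rewrite !eqxx orbT.
- exact: PP.
move=> i j ij; split.
- rewrite disjoint_subset; apply/subsetP => z zi; rewrite inE; apply/negP => zj.
  by have [] := R i j ij z z zi zj; rewrite eqxx.
- by move=> z w zi wj; have [] := R i j ij z w zi wj.
- exact: rungs_hole (PP i) (PP j) (R i j ij) (sz4 i j ij).
Qed.

End Linked.

Lemma I3_third (i j : 'I_3) : i != j ->
  exists k, [/\ i != k, j != k & forall h, [|| h == i, h == j | h == k]].
Proof.
(* The three indices sum to 3. *)
move=> ij; exists (inord (3 - i - j)); rewrite -!val_eqE /= inordK; last first.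
  by case: i j ij => [[|[|[|i]]] //= hi] [[|[|[|j]]] //= hj].
split; last (move=> h; rewrite -!val_eqE /= inordK);
  case: i j ij => [[|[|[|i]]] //= hi] [[|[|[|j]]] //= hj] //.
all: by case: h => [[|[|[|h]]]].
Qed.

(** * The pyramid in coordinates, and vertices away from Z *)

Section Coordinates.
Variables (V : finType) (E : rel V).
Hypotheses (E_sym : symmetric E) (E_irr : irreflexive E).
Hypotheses (G_theta_free : theta_free E) (G_prism_free : prism_free E).

(* [p i k] is the vertex at distance [k] from the apex on the i-th path, whose
   length is [n i]. *)
Variables (a : V) (n : 'I_3 -> nat) (p : 'I_3 -> nat -> V).
Hypothesis p0 : forall i, p i 0 = a.
Hypothesis n_gt0 : forall i, 0 < n i.
Hypothesis p_inj : forall i k l, k <= n i -> l <= n i ->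
  (p i k == p i l) = (k == l).
Hypothesis pE : forall i k l, k <= n i -> l <= n i ->
  E (p i k) (p i l) = (l == k.+1) || (k == l.+1).
Hypothesis p_cross : forall i j k l, i != j -> 0 < k <= n i -> 0 < l <= n j ->
  p i k != p j l /\ E (p i k) (p j l) = (k == n i) && (l == n j).

Definition seg i s t : {set V} := [set x in [seq p i k | k <- index_iota s t.+1]].

Lemma segP i s t x : reflect (exists2 k, s <= k <= t & x = p i k) (x \in seg i s t).
Proof.
rewrite inE; apply: (iffP mapP) => [[k]|[k st ->]].
  by rewrite mem_index_iota ltnS; exists k.
by exists k; rewrite ?mem_index_iota ?ltnS.
Qed.

Lemma mem_seg i s t k : s <= k <= t -> p i k \in seg i s t.
Proof. by move=> st; apply/segP; exists k. Qed.

Lemma linked_seg (T : {set V}) i s t : s <= t -> t <= n i ->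
  seg i s t \subset T -> linked E T (p i s) (p i t).
Proof.
elim: t => [|t IHt] st tn /subsetP sT.
  by move: st; rewrite leqn0 => /eqP ->; apply: connect0.
have [->|st'] := eqVneq s t.+1; first exact: connect0.
have {}st : s <= t by move: st; rewrite leq_eqVlt (negbTE st') ltnS.
apply: linked_trans (IHt st (ltnW tn) _) _.
  apply/subsetP => x /segP[k /andP[sk kt] ->].
  by apply: sT; apply: mem_seg; rewrite sk ltnW.
apply: linked1; rewrite ?pE ?eqxx // ?(ltnW tn) //; apply: sT; apply: mem_seg.
  by rewrite st /=.
by rewrite leqnn ltnW.
Qed.

Lemma linked_apex (T : {set V}) i t : t <= n i -> a \in T -> seg i 1 t \subset T ->
  linked E T (p i t) a.
Proof.
move=> tn aT /subsetP sT; rewrite linked_sym // -(p0 i).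
apply: linked_seg => //; apply/subsetP => x /segP[[|k] kt ->].
  by rewrite p0.
by apply: sT; apply: mem_seg.
Qed.

(** The long way to the apex: outwards to the base, over a base edge, and back along the k-th
    path. *)
Lemma linked_apex_base (T : {set V}) i k t : i != k -> 0 < t <= n i -> a \in T ->
  seg i t (n i) \subset T -> seg k 1 (n k) \subset T -> linked E T (p i t) a.
Proof.
move=> ik /andP[t0 tn] aT iT kT.
apply: linked_trans (linked_seg tn (leqnn _) iT) _.
apply: linked_trans (linked_apex (leqnn _) aT kT).
apply: linked1.
- by apply: (subsetP iT); apply: mem_seg; rewrite tn leqnn.
- by apply: (subsetP kT); apply: mem_seg; rewrite n_gt0 leqnn.
- by have [||_ ->] := p_cross (k := n i) (l := n k) ik; rewrite ?n_gt0 ?leqnn ?eqxx.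
Qed.

Lemma seg_separated i s t s' t' : t.+1 < s' -> t' <= n i ->
  separated E (seg i s t) (seg i s' t').
Proof.
move=> ts tn x y /segP[k /andP[sk kt] ->] /segP[l /andP[sl lt] ->].
by rewrite p_inj ?pE; clear - ts tn sk kt sl lt; lia.
Qed.

Lemma seg_separated_cross i j s t s' t' : i != j -> 0 < s -> 0 < s' ->
  t <= n i -> t' <= n j -> (t < n i) || (t' < n j) ->
  separated E (seg i s t) (seg j s' t').
Proof.
move=> ij s0 s0' tn tn' tt' x y /segP[k /andP[sk kt] ->] /segP[l /andP[sl lt] ->].
have [||-> ->] := p_cross (k := k) (l := l) ij.
- by rewrite (leq_trans s0) ?(leq_trans kt).
- by rewrite (leq_trans s0') ?(leq_trans lt).
- by split=> //; clear - kt lt tn tn' tt'; lia.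
Qed.

(** Extends [p_cross] to the apex, [k = 0], which [1 < l] keeps non-adjacent; [k < n i] excludes the
    base edge. *)
Lemma p_cross_inner i j k l : i != j -> k < n i -> 1 < l <= n j ->
  p i k != p j l /\ E (p i k) (p j l) = false.
Proof.
move=> ij kn /andP[l1 ln]; case: k kn => [|k] kn.
  rewrite p0 -(p0 j) p_inj ?pE //; split; first by case: l l1 {ln}.
  by case: l l1 {ln} => [|[|l]].
have [||-> ->] := p_cross (k := k.+1) (l := l) ij; rewrite ?(ltnW l1) ?(ltnW kn) //.
by rewrite ltn_eqF.
Qed.

(* A vertex outside the pyramid and outside the closed neighbourhood of Z. *)
Definition free (z : V) : Prop :=
  forall i k, k <= n i -> z != p i k /\ (E z (p i k) -> 1 < k < n i).

Lemma separated_seg (A : {set V}) i s t : t <= n i ->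
  (forall z, z \in A -> free z) ->
  (forall z l, z \in A -> s <= l <= t -> ~~ E z (p i l)) ->
  separated E A (seg i s t).
Proof.
move=> tn Af AE z x zA /segP[k kt ->].
have /andP[_ kt'] := kt.
by rewrite AE //; have [->] := Af z zA i k (leq_trans kt' tn).
Qed.

Lemma free_neq_apex z : free z -> z != a.
Proof. by move=> /(_ ord0 0 (leq0n _))[]; rewrite p0. Qed.

Lemma free_nonadj_apex z : free z -> ~~ E z a.
Proof.
by move=> /(_ ord0 0 (leq0n _))[_]; rewrite p0; case: (E z a) => // /(_ isT).
Qed.

(** From [z], enter each path at a neighbour and follow it to the apex. These neighbours precede the
    base, so no base edge joins two routes, and they form a theta. *)
Lemma free_attach_all z : free z ->
  (forall i, exists2 k, k <= n i & E z (p i k)) -> False.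
Proof.
move=> zf zp.
have link i q : q <= n i -> E z (p i q) ->
    linked E ([set z; a] :|: seg i 1 q) z a.
  move=> qn zq; have [_ /(_ zq) /andP[q1 _]] := zf i q qn.
  apply: linked_trans (linked_apex qn _ _).
  - apply: linked1 zq; apply/setUP; first by left; rewrite !inE eqxx.
    by right; apply: mem_seg; rewrite leqnn ltnW.
  - by rewrite !inE eqxx orbT.
  - exact: subsetUr.
have lt i q : q <= n i -> E z (p i q) -> q < n i.
  by move=> qn zq; have [_ /(_ zq) /andP[_ q1]] := zf i q qn.
have [q1 n1 E1] := zp ord0.
have [q2 n2 E2] := zp (inord 1).
have [q3 n3 E3] := zp (inord 2).
apply: (separated_theta E_sym E_irr G_theta_free (free_neq_apex zf)
  (free_nonadj_apex zf) (link _ _ n1 E1) (link _ _ n2 E2) (link _ _ n3 E3));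
apply: seg_separated_cross; rewrite ?(lt _ _ n1) ?(lt _ _ n2) //;
  by rewrite -val_eqE /= !inordK.
Qed.

(** * Attachment of a connected set to two paths of the pyramid *)

Section Attachment.
Variables (i j k : 'I_3) (T : {set V}) (r r' : V).
Hypotheses (ij : i != j) (ik : i != k) (jk : j != k).
Hypothesis T_free : forall z, z \in T -> free z.
Hypotheses (rT : r \in T) (rT' : r' \in T) (T_link : linked E T r r').
Hypothesis T_i : forall z l, z \in T -> l <= n i -> E z (p i l) -> z = r.
Hypothesis T_k : forall z l, z \in T -> l <= n k -> ~~ E z (p k l).
Hypothesis r_i : exists2 l, l <= n i & E r (p i l).
Hypothesis r_j : exists2 l, l <= n j & E r' (p j l).

(** Let [lo] and [hi] be the first and last neighbours of [r] on the i-th path. Unless [hi = lo.+1],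
    there is a theta with three routes to the apex: inwards along the i-th path; through [T] and
    along the j-th path; outwards along the i-th path to the base and back along the k-th. *)
Lemma attachment_edge : exists l,
  [/\ 1 < l, l.+1 < n i &
      forall q, q <= n i -> E r (p i q) = (q == l) || (q == l.+1)].
Proof.
have [t tn rt] := r_j.
have /andP[t1 tn'] : 1 < t < n j by have [_ ->] := T_free rT' tn.
have far q : q <= n i -> E r (p i q) -> 1 < q < n i.
  by move=> qn rq; have [_ ->] := T_free rT qn.
pose Q q := (q <= n i) && E r (p i q).
have Q0 : exists q, Q q by have [l ln rl] := r_i; exists l; rewrite /Q ln.
have Qb q : Q q -> q <= n i by case/andP.
have [lo /andP[lon rlo] lo_min] := ex_minnP Q0.
have [hi /andP[hin rhi] hi_max] := ex_maxnP Q0 Qb.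
have /andP[lo1 lon'] := far lo lon rlo.
have /andP[hi1 hin'] := far hi hin rhi.
have lohi : lo <= hi by apply: lo_min; rewrite /Q hin.
have lo_out q : q <= n i -> q < lo -> ~~ E r (p i q).
  by move=> qn; rewrite ltnNge; apply: contra => rq; apply: lo_min; rewrite /Q qn.
have hi_out q : q <= n i -> hi < q -> ~~ E r (p i q).
  by move=> qn; rewrite ltnNge; apply: contra => rq; apply: hi_max; rewrite /Q qn.
have T_i' z l : z \in T -> l <= n i -> ~~ E r (p i l) -> ~~ E z (p i l).
  by move=> zT ln; apply: contra => zl; rewrite -(T_i zT ln zl).
have link_r (U : {set V}) : T \subset U -> a \in U -> seg j 1 t \subset U ->
    linked E U r a.
  move=> TU aU jU; apply: linked_trans (linked_sub TU T_link) _.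
  apply: linked_trans (linked_apex tn aU jU).
  apply: linked1 rt; first exact: (subsetP TU).
  by apply: (subsetP jU); apply: mem_seg; rewrite leqnn ltnW.
have S12 q : q <= n i -> separated E (seg i 1 q) (seg j 1 t).
  by move=> qn; apply: seg_separated_cross; rewrite ?tn' ?orbT.
have S13 q s : q.+1 < s -> q < n i ->
    separated E (seg i 1 q) (seg i s (n i) :|: seg k 1 (n k)).
  move=> qs qn; apply: separatedUr; first exact: seg_separated.
  by apply: seg_separated_cross; rewrite ?qn // ltnW.
have S23 s : 0 < s -> separated E (seg j 1 t) (seg i s (n i) :|: seg k 1 (n k)).
  move=> s0; apply: separatedUr; apply: seg_separated_cross;
  by rewrite ?tn' // eq_sym.
have T3 s (A : {set V}) : A \subset T ->
    (forall z l, z \in A -> s <= l <= n i -> ~~ E z (p i l)) ->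
    separated E A (seg i s (n i) :|: seg k 1 (n k)).
  move=> /subsetP AT Ai; apply: separatedUr; apply: separated_seg => //.
  - by move=> z /AT/T_free.
  - by move=> z /AT/T_free.
  - by move=> z l /AT zT /andP[_ ln]; apply: T_k.
have seg_lo (U : {set V}) q : q <= n i -> p i q \in U -> seg i 1 q.-1 \subset U ->
    seg i 1 q \subset U.
  move=> qn qU /subsetP iU; apply/subsetP => _ /segP[l /andP[l1 lq] ->].
  have [-> //|lq'] := eqVneq l q.
  by apply: iU; apply: mem_seg; clear - l1 lq lq'; lia.
have seg_hi (U : {set V}) q : p i q \in U -> seg i q.+1 (n i) \subset U ->
    seg i q (n i) \subset U.
  move=> qU /subsetP iU; apply/subsetP => _ /segP[l /andP[l1 lq] ->].
  have [-> //|lq'] := eqVneq l q.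
  by apply: iU; apply: mem_seg; clear - l1 lq lq'; lia.
have [hilo|lohi'|hiE] := ltngtP hi lo.+1.
(* One neighbour: the ends are [p i lo] and [a]. All of [T] fits in the second route, since it sees
   the i-th path only in [p i lo]. *)
- have {hilo} hiE : hi = lo by clear - hilo lohi; lia.
  rewrite {}hiE {hi hin rhi hi1 hin' hi_max lohi} in hi_out.
  have onlylo q : q <= n i -> q != lo -> ~~ E r (p i q).
    by rewrite neq_ltn => qn /orP[]; [apply: lo_out | apply: hi_out].
  have loa : p i lo != a by rewrite -(p0 i) p_inj // -lt0n ltnW.
  have nloa : ~~ E (p i lo) a.
    by rewrite -(p0 i) pE //; clear - lo1; lia.
  case: (@separated_theta _ _ E_sym E_irr (p i lo) a (seg i 1 lo.-1)
    (T :|: seg j 1 t) (seg i lo.+1 (n i) :|: seg k 1 (n k))) => //.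
  + by apply: linked_apex => //; [rewrite !inE eqxx orbT | apply: seg_lo => //;
      [rewrite !inE eqxx | exact: subsetUr]].
  + apply: linked_trans (link_r _ _ _ _).
    * by apply: linked1; rewrite ?(E_sym _ r) // !inE ?eqxx ?rT ?orbT.
    * by rewrite setUCA subsetUl.
    * by rewrite !inE eqxx orbT.
    * by rewrite setUA subsetUr.
  + apply: (linked_apex_base ik).
    * by rewrite lon ltnW.
    * by rewrite !inE eqxx orbT.
    * apply: seg_hi; first by rewrite !inE eqxx.
      by rewrite setUCA subsetUl.
    * by rewrite setUA subsetUr.
  + apply: separatedUr; last by apply: S12; rewrite (leq_trans (leq_pred _)).
    apply: separated_sym => //; apply: separated_seg => //.
      by rewrite (leq_trans (leq_pred _)).
    move=> z l zT /andP[l1 llo]; have ln : l <= n i by clear - llo lon; lia.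
    by apply: T_i' => //; apply: lo_out => //; clear - llo lo1; lia.
  + by apply: S13; clear - lo1 lon'; lia.
  + apply: separatedUl; last exact: S23.
    apply: T3 => // z l zT /andP[lol ln].
    by apply: T_i' => //; apply: hi_out.
(* Here [hi] exceeds [lo.+1]: the ends are [r] and [a]. Without [r], the set [T] sees nothing of the
   i-th path, and the gap between [lo] and [hi] separates the other two routes. *)
- have ra := free_neq_apex (T_free rT).
  have nra := free_nonadj_apex (T_free rT).
  have nr z l : z \in T :\ r -> l <= n i -> ~~ E z (p i l).
    move=> /setD1P[zr zT] ln; apply: contra zr => zl.
    by rewrite (T_i zT ln zl).
  case: (@separated_theta _ _ E_sym E_irr r a (seg i 1 lo)
    (T :\ r :|: seg j 1 t) (seg i hi (n i) :|: seg k 1 (n k))) => //.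
  + apply: linked_trans (linked_apex lon _ _); last exact: subsetUr.
      apply: linked1 rlo; apply/setUP; first by left; rewrite !inE eqxx.
      by right; apply: mem_seg; rewrite leqnn ltnW.
    by rewrite !inE eqxx orbT.
  + apply: link_r.
    * apply/subsetP => z zT; rewrite !inE zT.
      by case: (z == r); rewrite ?orbT.
    * by rewrite !inE eqxx orbT.
    * by rewrite setUA subsetUr.
  + have iU : seg i hi (n i) \subset [set r; a] :|: (seg i hi (n i) :|: seg k 1 (n k)).
      by rewrite setUCA subsetUl.
    apply: linked_trans (linked_apex_base ik _ _ iU _).
    * apply: linked1 rhi; first by rewrite !inE eqxx.
      by apply: (subsetP iU); apply: mem_seg; rewrite leqnn.
    * by rewrite hin ltnW.
    * by rewrite !inE eqxx orbT.
    * by rewrite setUA subsetUr.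
  + apply: separatedUr; last exact: S12.
    apply: separated_sym => //; apply: separated_seg => //.
      by move=> z /setD1P[_ /T_free].
    by move=> z l zT /andP[_ llo]; apply: nr => //; apply: leq_trans lon.
  + exact: S13.
  + apply: separatedUl; last by apply: S23; apply: ltnW.
    apply: T3; first exact: subsetDl.
    by move=> z l zT /andP[_ ln]; apply: nr.
- exists lo; split=> //; first by rewrite -hiE.
  move=> q qn; have [->|qlo] := eqVneq q lo; first by rewrite rlo.
  have [->|qhi] /= := eqVneq q lo.+1; first by rewrite -hiE rhi.
  apply/negbTE; move: qlo; rewrite neq_ltn => /orP[qlo|qlo].
    exact: lo_out.
  by apply: hi_out => //; rewrite hiE ltn_neqAle eq_sym qhi.
Qed.

End Attachment.

(** The triangles are [r], [p i l], [p i l.+1] and [r'], [p j l'], [p j l'.+1]. The paths between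
    them run through [T], through the apex, and over a base edge; the first has length zero if
    [r = r']. *)
Lemma attachment_prism (i j : 'I_3) (T : {set V}) (r r' : V) l l' :
  i != j -> (forall z, z \in T -> free z) ->
  r \in T -> r' \in T -> linked E T r r' ->
  (forall z q, z \in T -> q <= n i -> E z (p i q) -> z = r) ->
  (forall z q, z \in T -> q <= n j -> E z (p j q) -> z = r') ->
  1 < l -> l.+1 < n i ->
  (forall q, q <= n i -> E r (p i q) = (q == l) || (q == l.+1)) ->
  1 < l' -> l'.+1 < n j ->
  (forall q, q <= n j -> E r' (p j q) = (q == l') || (q == l'.+1)) -> False.
Proof.
move=> ij Tf rT rT' T_link Ti Tj l1 ln rE l1' ln' rE'.
have ji : j != i by rewrite eq_sym.
have TiE z q : z \in T -> q <= n i ->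
    E z (p i q) = (z == r) && ((q == l) || (q == l.+1)).
  move=> zT qn; have [->|zr] := eqVneq z r; first by rewrite rE.
  by apply: contraNF zr => /(Ti _ _ zT qn) ->.
have TjE z q : z \in T -> q <= n j ->
    E z (p j q) = (z == r') && ((q == l') || (q == l'.+1)).
  move=> zT qn; have [->|zr] := eqVneq z r'; first by rewrite rE'.
  by apply: contraNF zr => /(Tj _ _ zT qn) ->.
have inner h m q q' : h != m -> q < n h -> 1 < q' <= n m ->
    (p h q == p m q' = false) /\ E (p h q) (p m q') = false.
  by move=> hm qn qn'; have [/negbTE ->] := p_cross_inner hm qn qn'.
have inner' h m q q' : h != m -> q <= n h -> 1 < q' < n m -> p h q == p m q' = false.
  move=> hm qn /andP[q1 /ltnW qn']; case: q qn => [|q] qn.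
    by have [|] := inner h m 0 q' hm (n_gt0 h); first by rewrite q1.
  have [||/negbTE -> //] := p_cross (k := q.+1) (l := q') hm; rewrite ?qn //.
  by rewrite (ltnW q1).
have lnW := ltnW ln; have lnWW := ltnW lnW.
have lnW' := ltnW ln'; have lnWW' := ltnW lnW'.
have l1W : 1 < l.+1 := leqW l1; have l1W' : 1 < l'.+1 := leqW l1'.
have inner_l q : q <= n j -> (p j q == p i l = false) * (p j q == p i l.+1 = false).
  by move=> qn; rewrite !inner' ?l1 ?l1W.
have inner_l' q : q <= n i -> (p i q == p j l' = false) * (p i q == p j l'.+1 = false).
  by move=> qn; rewrite !inner' ?l1' ?l1W'.
apply: (@rungs_prism _ _ E_sym E_irr r (p i l) (p i l.+1) r' (p j l') (p j l'.+1)
  T (seg i 0 l :|: seg j 0 l') (seg i l.+1 (n i) :|: seg j l'.+1 (n j))) => //.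
- by apply/setUP; left; apply: mem_seg; rewrite leqnn.
- by apply/setUP; left; apply: mem_seg; rewrite leqnn.
- by apply/setUP; right; apply: mem_seg; rewrite leqnn.
- by apply/setUP; right; apply: mem_seg; rewrite leqnn.
- apply: (@linked_trans _ _ _ a); [|rewrite linked_sym //];
  apply: linked_apex => //.
  + by rewrite -(p0 i); apply/setUP; left; apply: mem_seg.
  + apply/subsetP => _ /segP[q /andP[_ qn] ->].
    by apply/setUP; left; apply: mem_seg.
  + by rewrite -(p0 i); apply/setUP; left; apply: mem_seg.
  + apply/subsetP => _ /segP[q /andP[_ qn] ->].
    by apply/setUP; right; apply: mem_seg.
- apply: linked_trans (linked_seg lnW (leqnn _) (subsetUl _ _)) _.
  rewrite linked_sym //.
  apply: linked_trans (linked_seg lnW' (leqnn _) (subsetUr _ _)) _.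
  apply: linked1.
  + by apply/setUP; right; apply: mem_seg; rewrite lnW' leqnn.
  + by apply/setUP; left; apply: mem_seg; rewrite lnW leqnn.
  + by have [||_ ->] := p_cross (k := n j) (l := n i) ji; rewrite ?n_gt0 ?leqnn ?eqxx.
- by rewrite inner_l'.
- by have [|_ ->] := inner _ _ l l' ij lnW; rewrite ?l1' ?lnWW'.
- by rewrite inner_l'.
- by have [|_ ->] := inner _ _ l.+1 l'.+1 ij ln; rewrite ?l1W' ?lnW'.
- move=> z _ zT /setUP[] /segP[q /andP[_ ql] ->].
  + have qn : q <= n i by apply: leq_trans lnWW.
    have [-> _] := Tf z zT i q qn; split=> //.
    by rewrite TiE // p_inj // inner_l' // andbF orbF (ltn_eqF (n := l.+1)) // orbF.
  + have qn : q <= n j by apply: leq_trans lnWW'.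
    have [-> _] := Tf z zT j q qn; split=> //.
    by rewrite TjE // p_inj // inner_l // andbF /= (ltn_eqF (n := l'.+1)) // orbF.
- move=> z _ zT /setUP[] /segP[q /andP[lq qn] ->].
  + have [-> _] := Tf z zT i q qn; split=> //.
    by rewrite TiE // p_inj // inner_l' // andbF orbF (gtn_eqF lq).
  + have [-> _] := Tf z zT j q qn; split=> //.
    by rewrite TjE // p_inj // inner_l // andbF /= (gtn_eqF lq).
(* Parts of one path are joined only by the edge at [l] or [l']. Parts of different paths are not
   joined: one stops before the base, the other stays at distance more than one from the apex. *)
- move=> _ _ /setUP[] /segP[q /andP[_ ql] ->] /setUP[] /segP[q' /andP[lq qn] ->].
  + have qn' : q <= n i by apply: leq_trans lnWW.
    rewrite pE // !p_inj // inner_l' //=; clear - ql lq; lia.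
  + have qn' : q < n i by apply: leq_ltn_trans lnW.
    have [|-> ->] := inner _ _ q q' ij qn'; first by rewrite qn (leq_trans l1W' lq).
    by rewrite inner_l // inner_l' ?(ltnW qn') // !andbF.
  + have qn' : q < n j by apply: leq_ltn_trans lnW'.
    have [|-> ->] := inner _ _ q q' ji qn'; first by rewrite qn (leq_trans l1W lq).
    by rewrite inner_l ?(ltnW qn') // inner_l' // !andbF.
  + have qn' : q <= n j by apply: leq_trans lnWW'.
    rewrite pE // !p_inj // inner_l //=; clear - ql lq; lia.
Qed.

(** * Walks of far vertices between two paths of the pyramid *)

(* A vertex outside the closed neighbourhood of Z, possibly on the pyramid. *)
Definition far (z : V) : Prop :=
  forall i k, k <= n i -> (z == p i k) || E z (p i k) -> 1 < k < n i.

(** Lying on a path counts as attaching to it, so walks may start and end on the pyramid. *)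
Definition attached (z : V) (i : 'I_3) : Prop :=
  exists2 k, k <= n i & (z == p i k) || E z (p i k).

(** Being far, the vertex precedes the base and attaches only at distance more than one from the
    apex, so [p_cross_inner] excludes the other paths. *)
Lemma far_attached i j k : k <= n i -> far (p i k) -> attached (p i k) j -> j = i.
Proof.
move=> kn zf [l ln zl]; apply/eqP; apply/negP => /negP; rewrite eq_sym => ij.
have /andP[k1 kn'] : 1 < k < n i by apply: zf kn _; rewrite eqxx.
have /andP[l1 _] := zf _ _ ln zl.
have [|/negbTE H1 H2] := @p_cross_inner i j k l ij kn'; first by rewrite l1.
by rewrite H1 H2 in zl.
Qed.

Lemma far_free z : far z -> (forall i k, k <= n i -> z != p i k) -> free z.
Proof. by move=> zf zp i k kn; split=> [|zk]; [apply: zp | apply: zf kn _; rewrite zk orbT]. Qed.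

Lemma path_linked (x : V) s : path E x s -> linked E [set z in x :: s] x (last x s).
Proof.
elim: s x => [|y s IHs] x; first by move=> _; apply: connect0.
case/andP=> xy ys; apply: linked_trans (linked_sub _ (IHs y ys)).
  by apply: linked1 => //; rewrite !inE eqxx ?orbT.
by apply/subsetP => z; rewrite !inE => ->; rewrite orbT.
Qed.

(* Induction on the length of the walk: either some proper subwalk still joins
   two paths of the pyramid, or only the ends of the walk attach to the
   pyramid, and the walk together with the pyramid contains a theta or a prism. *)
Lemma no_far_walk (s : seq V) (r : V) i j :
  i != j -> path E r s -> (forall z, z \in r :: s -> far z) ->
  attached r i -> attached (last r s) j -> False.
Proof.
have [m] := ubnP (size s); elim: m s r i j => // m IHm s r i j ssz ij rs sf ri rj.
have rf : far r by apply: sf; rewrite mem_head.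
(* Otherwise the rest of the walk from [z] is shorter and joins [h] to [j]. *)
have F1 z h : z \in r :: s -> z != r -> attached z h -> h = j.
  rewrite inE => /orP[/eqP ->|zs]; first by rewrite eqxx.
  move=> zr zh; apply/eqP; apply/negP => /negP hj.
  case/splitPr: zs ssz rs sf rj => s1 s2.
  rewrite size_cat cat_path last_cat /= => ssz /and3P[_ _ rs] sf rj.
  apply: (IHm s2 z h j) => //; first by clear - ssz; lia.
  by move=> w ws; apply: sf; rewrite inE mem_cat ws !orbT.
(* Otherwise the walk up to [z] is shorter and joins [i] to [h]. *)
have F2 z h : z \in r :: s -> z != last r s -> attached z h -> h = i.
  move=> zs zr zh; apply/eqP; apply/negP => /negP; rewrite eq_sym => ih.
  move: zs; rewrite inE => /orP[/eqP zE|zs].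
    rewrite {}zE in zr zh; apply: (IHm [::] r i h) => //.
      by case: s zr ssz {rs sf rj F1} => [|? ? _]; rewrite /= ?eqxx // ltnS; apply: leq_ltn_trans.
    by move=> w; rewrite inE => /eqP ->.
  case/path.splitP: zs ssz rs sf zr {F1 rj} => s1 s2.
  rewrite size_cat cat_path last_cat last_rcons => ssz /andP[rs _] sf zr.
  apply: (IHm (rcons s1 z) r i h) => //; last by rewrite last_rcons.
    by case: s2 zr ssz {sf} => [|w s2 _]; rewrite ?eqxx //=; clear; lia.
  by move=> w; rewrite inE => ws; apply: sf; rewrite inE mem_cat orbA ws.
(* The walk avoids the pyramid: a walk vertex on it attaches to its own path only, so it is an end
   of the walk. Dropping it leaves a shorter walk, because its neighbour on the walk attaches to the
   same path. *)
have off z : z \in r :: s -> forall h k, k <= n h -> z != p h k.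
  move=> zs h k kn; apply/eqP => zE.
  have zf := sf _ zs; have zh : attached z h by exists k; rewrite // zE eqxx.
  have zatt g : attached z g -> g = h by rewrite zE in zf *; apply: far_attached.
  have [zr|zr] := eqVneq z r; last first.
    have hj := F1 z h zs zr zh.
    have [zr'|zr'] := eqVneq z (last r s); last first.
      by move: ij; rewrite -hj (F2 z h zs zr' zh) eqxx.
    move: zr'; case/lastP: s ssz rs sf rj F1 F2 zs => [|s w] ssz rs sf rj F1 F2 zs.
      by move=> zr'; rewrite zr' eqxx in zr.
    rewrite last_rcons => zw; subst w.
    move: rs; rewrite rcons_path => /andP[rs sz].
    apply: (IHm s r i j) => //; first by move: ssz; rewrite size_rcons.
      by move=> w ws; apply: sf; rewrite inE mem_rcons inE orbCA -in_cons ws orbT.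
    by exists k; rewrite -?hj // -zE sz orbT.
  have hi : i = h by apply: zatt; rewrite zr.
  case: s ssz rs sf rj {F1 F2 zs} => [|w s] /= ssz rs sf rj.
    by move: ij; rewrite hi (zatt j) ?eqxx // zr.
  have /andP[rw ws] := rs.
  apply: (IHm s w i j) => //.
    by move=> y ys; apply: sf; rewrite inE ys orbT.
  by exists k; rewrite hi // -zE zr E_sym rw orbT.
pose T := [set z in r :: s].
have Tf z : z \in T -> free z.
  by rewrite inE => zs; apply: far_free; [apply: sf | apply: off].
have Ts z : z \in T -> z \in r :: s by rewrite inE.
have att z h q : q <= n h -> E z (p h q) -> attached z h.
  by move=> qn zq; exists q; rewrite // zq orbT.
have rT : r \in T by rewrite inE mem_head.
have rT' : last r s \in T by rewrite inE mem_last.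
have rlink : linked E T r (last r s) by apply: path_linked.
have rnbr z h : z \in T -> attached z h -> exists2 q, q <= n h & E z (p h q).
  by move=> zT [q qn]; rewrite (negbTE (off z (Ts z zT) h q qn)); exists q.
have Ti z q : z \in T -> q <= n i -> E z (p i q) -> z = r.
  move=> /Ts zT qn zq; apply/eqP; apply/negP => /negP zr.
  by move: ij; rewrite (F1 z i zT zr (att _ _ _ qn zq)) eqxx.
have Tj z q : z \in T -> q <= n j -> E z (p j q) -> z = last r s.
  move=> /Ts zT qn zq; apply/eqP; apply/negP => /negP zr.
  by move: ij; rewrite (F2 z j zT zr (att _ _ _ qn zq)) eqxx.
have [k [ik jk ijk]] := I3_third ij.
(* A vertex attached to the third path must be both ends of the walk, hence attached to all three
   paths. *)
have Tk z q : z \in T -> q <= n k -> ~~ E z (p k q).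
  move=> zT qn; apply/negP => zq; have zk := att _ _ _ qn zq.
  have zr : z = r.
    apply/eqP; apply/negP => /negP zr.
    by move: jk; rewrite (F1 z k (Ts z zT) zr zk) eqxx.
  have zr' : z = last r s.
    apply/eqP; apply/negP => /negP zr'.
    by move: ik; rewrite (F2 z k (Ts z zT) zr' zk) eqxx.
  apply: (free_attach_all (Tf z zT)) => h; apply: rnbr => //.
  have /or3P[] := ijk h => /eqP -> //; first by rewrite zr.
  by rewrite zr'.
have [l [l1 ln lE]] :=
  attachment_edge ij ik jk Tf rT rT' rlink Ti Tk (rnbr _ _ rT ri) (rnbr _ _ rT' rj).
(* The reversed walk gives the same at the other end. *)
have ji : j != i by rewrite eq_sym.
have rlink' : linked E T (last r s) r by rewrite linked_sym.
have [l' [l1' ln' lE']] :=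
  attachment_edge ji jk ik Tf rT' rT rlink' Tj Tk (rnbr _ _ rT' rj) (rnbr _ _ rT ri).
exact: (attachment_prism ij Tf rT rT' rlink Ti Tj l1 ln lE l1' ln' lE').
Qed.

End Coordinates.

(** * Passage to coordinates, and the separation given by a component *)

Theorem theorem4p1 (V : finType) (E : rel V)
  (E_sym : symmetric E) (E_irr : irreflexive E)
  (G_theta_free : theta_free E) (G_prism_free : prism_free E)
  (a : V) (b : 'I_3 -> V) (P : 'I_3 -> seq V) (Sigma : pyramid E a b P)
  (u v : V)
  (u_notin : u \notin closed_nbhd E (pyramid_Z E a b P))
  (v_notin : v \notin closed_nbhd E (pyramid_Z E a b P))
  (i j : 'I_3) (ij : i != j) (u_in : u \in P i) (v_in : v \in P j) :
  separates E (closed_nbhd E (pyramid_Z E a b P)) u v.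
Proof.
set M := closed_nbhd _ _ in u_notin v_notin *.
have [_ ab Ppath Pcross] := Sigma.
have Pind h : induced_path E a (b h) (P h) by case: (Ppath h).
pose n h := (size (P h)).-1.
pose p h k := nth a (P h) k.
have szP h : size (P h) = (n h).+1 by rewrite /n; case: (Pind h); case: (P h).
have ltP h k : k <= n h -> k < size (P h) by rewrite szP ltnS.
have p0 h : p h 0 = a by rewrite /p nth0; case: (Pind h).
have pn h : p h (n h) = b h by rewrite /p /n nth_last; case: (Pind h).
have n_gt0 h : 0 < n h by case: (Ppath h).
have p_inj h k l : k <= n h -> l <= n h -> (p h k == p h l) = (k == l).
  by move=> kn ln; rewrite /p nth_uniq ?ltP //; case: (Pind h).
have pE h k l : k <= n h -> l <= n h ->
    E (p h k) (p h l) = (l == k.+1) || (k == l.+1).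
  by move=> kn ln; have [_ _ _ _ ->] := Pind h; rewrite ?ltP.
have pP h k : k <= n h -> p h k \in P h by move=> kn; rewrite mem_nth ?ltP.
have p_cross h g k l : h != g -> 0 < k <= n h -> 0 < l <= n g ->
    p h k != p g l /\ E (p h k) (p g l) = (k == n h) && (l == n g).
  move=> hg /andP[k0 kn] /andP[l0 ln]; have [dis adj _] := Pcross h g hg.
  have inD m q : 0 < q -> q <= n m -> p m q \in [set x in P m] :\ a.
    by move=> q0 qn; rewrite !inE pP // -(p0 m) p_inj // -lt0n q0.
  split; last by rewrite adj ?inD // -!pn !p_inj.
  apply/eqP => pe; move/pred0P: dis => /(_ (p h k)) /=.
  by rewrite inD // pe inD.
have PpE h z : z \in P h -> exists2 k, k <= n h & z = p h k.
  by move=> /(nthP a)[k]; rewrite szP ltnS => kn <-; exists k.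
(* If [z] equals or is adjacent to [p h k], then [p h k] is outside Z, which excludes [k <= 1] and
   [k = n h]. *)
have MP z : z \notin M -> far E n p z.
  rewrite !inE negb_or => /andP[zZ /existsPn zN] h k kn zk.
  have ZN w : w \in pyramid_Z E a b P -> (z != w) && ~~ E z w.
    move=> wZ; have := zN w; rewrite wZ /= => ->; rewrite andbT.
    by apply: contraNneq zZ => ->; rewrite !inE in wZ *.
  have {}zk : p h k \notin pyramid_Z E a b P.
    by apply: contraL zk => /ZN; rewrite negb_or.
  have k1 : 1 < k.
    rewrite ltnNge; apply: contra zk => k1; rewrite !inE; apply/orP; left.
    apply/andP; split; first by apply/existsP; exists h; apply: pP.
    rewrite -(p0 h) p_inj // pE //; case: k k1 kn => [|[|k]] //.
  rewrite k1 ltn_neqAle kn andbT; apply: contra zk => /eqP ->.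
  by rewrite pn !inE imset_f ?orbT.
split.
  apply/subsetP => z zM; rewrite !inE; apply/norP.
  by split; apply: contraTneq zM => ->.
clearbody M.
(* The component of [u] after deleting [M]; the rest of the complement of [M] is the other side. *)
pose L := [set z | (z \notin M) && linked E (~: M) u z].
have uL : u \in L by rewrite inE u_notin; apply: connect0.
(* A walk from [u] to [v] outside [M] would be a far walk joining two paths. *)
have vL : v \notin L.
  rewrite inE v_notin; apply/negP => /connectP[s us vE].
  have uvs : forall z, z \in u :: s -> far E n p z.
    move=> z; rewrite inE => /orP[/eqP ->|zs]; first exact: MP.
    apply: MP; case/splitPr: zs us {vE} => s1 s2.
    by rewrite cat_path /= => /and3P[_ /and3P[_ + _] _]; rewrite inE.
  have [k kn ue] := PpE i u u_in; have [l ln ve] := PpE j v v_in.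
  apply: (no_far_walk E_sym E_irr G_theta_free G_prism_free p0 n_gt0 p_inj pE
    p_cross ij (s := s) (r := u)) => //.
  - by apply: sub_path us => x y /and3P[].
  - by exists k; rewrite // ue eqxx.
  - by exists l; rewrite // -vE ve eqxx.
have LM z : z \in L -> z \notin M by rewrite inE => /andP[].
have vR : v \in ~: (L :|: M) by rewrite in_setC in_setU negb_or vL.
exists L, (~: (L :|: M)); split=> //.
split.
- split; apply/pred0P => z /=; rewrite ?in_setC ?in_setU.
  + by apply/negP => /andP[/LM/negbTE ->].
  + by case: (z \in M); rewrite ?orbT.
  + by case: (z \in L).
- by rewrite setUCr.
- by apply/set0Pn; exists u.
- by apply/set0Pn; exists v.
- move=> x y xL; rewrite in_setC in_setU negb_or => /andP[yL yM].
  apply: contra yL => xy; rewrite inE yM /=.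
  have := xL; rewrite inE => /andP[xM ux]; apply: linked_trans ux _.
  by apply: linked1 => //; rewrite inE.
Qed.
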